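(* Let $\mathcal{S}$ be a mutation class of labelled seeds (cluster structure) on $\mathcal{F}$, with associated cluster algebra $\mathcal{A}$. For $w\in W^{\mathrm{c}}$ let $\alpha_w=\beta_{w\cdot x}\circ\beta_x^{-1}\in\operatorname{Aut}(\mathcal{F})$, where $x\in\mathcal{S}$ is any labelled seed (this is independent of $x$). Then the maps $\alpha\colon W^{\mathrm{c}}\to\operatorname{Aut}^{\mathrm{c}}(\mathcal{A})$, $w\mapsto\alpha_w$, and $\alpha^+=\alpha|_{W^+}\colon W^+\to\operatorname{Aut}^{+}(\mathcal{A})$ are group isomorphisms.
   Context: Fix $n\ge 1$, $I=\{1,\dots,n\}$, a purely transcendental field extension $\mathcal{F}$ of $\mathbb{Q}$ of transcendence degree $n$, and $\mathcal{K}=\mathbb{Q}(x_1,\dots,x_n)$. A quiver $Q$ on a finite set (without loops or 2-cycles) is the data of its adjacency matrix $(a_{ij})$ of non-negative integers, $a_{ij}$ being the multiplicity of the arrow $i\to j$, with $a_{ii}=0$ and $a_{ij}a_{ji}=0$; two quivers are equal iff their adjacency matrices are. It is determined by the skew-symmetric matrix $b_{ij}=a_{ij}-a_{ji}$. Quivers may be disconnected. A labelled seed is a pair $(Q,\beta)$ with $Q$ a quiver on $I$ and $\beta=(\beta_1,\dots,\beta_n)\in\mathcal{F}^n$ freely generating $\mathcal{F}$; $\beta$ is also regarded as the isomorphism $\beta\colon\mathcal{K}\to\mathcal{F}$, $x_i\mapsto\beta_i$. Write $x=(Q_x,\beta_x)$ for a labelled seed $x$. Mutation at $i\in I$: $(Q,\beta)\cdot\mu_i=(Q',\beta')$,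 where $b'_{jk}=-b_{jk}$ if $i\in\{j,k\}$ and $b'_{jk}=b_{jk}+a_{ji}a_{ik}-a_{ki}a_{ij}$ otherwise, and $\beta'_j=\beta_j$ for $j\neq i$, $\beta'_i=\big(\prod_{k}\beta_k^{a_{ki}}+\prod_{k}\beta_k^{a_{ik}}\big)/\beta_i$. Relabelling: for $\sigma\in\mathfrak{S}_n$, $(Q,\beta)\cdot\sigma=(Q^\sigma,\beta^\sigma)$ where $\beta^\sigma_i=\beta_{\sigma(i)}$ and $Q^\sigma$ has adjacency matrix $a^\sigma_{ij}=a_{\sigma(i)\sigma(j)}$. These combine to a right action of the mutation group $M_n=\mathfrak{S}_n\ltimes\langle\mu_1,\dots,\mu_n:\mu_i^2=1\rangle$, in which $\sigma\mu_i=\mu_{\sigma(i)}\sigma$. A mutation class (cluster structure) is an $M_n$-orbit $\mathcal{S}$ of labelled seeds. An (unlabelled) seed is a pair $(Q,\mathbf{b})$ with $\mathbf{b}\subset\mathcal{F}$ a free generating set and $Q$ a quiver with vertex set $\mathbf{b}$. Each labelled seed $(Q,\beta)$ determines an unlabelled seed by replacing vertex $i$ by $\beta_i$. The seeds of $\mathcal{A}$ are the unlabelled seeds arising from elements of $\mathcal{S}$; the cluster algebra $\mathcal{A}\subset\mathcal{F}$ is the subalgebra generated by all $\beta_i$, $(Q,\beta)\in\mathcal{S}$. An automorphism $f\in\operatorname{Aut}(\mathcal{F})$ sends a seed $(Q,\mathbf{b})$ to $(Q,f(\mathbf{b}))$ (each vertex $v$ replaced by $f(v)$, arrows fixed). $\operatorname{Aut}^{\mathrm{c}}(\mathcal{A})$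 is the group of cluster automorphisms: those $f\in\operatorname{Aut}(\mathcal{F})$ such that for every seed $(Q,\mathbf{b})$ of $\mathcal{A}$, $(Q,f(\mathbf{b}))$ is a seed of $\mathcal{A}$ up to reversing the orientation of some connected components of $Q$. $\operatorname{Aut}^{+}(\mathcal{A})$ is the subgroup of direct cluster automorphisms, for which $(Q,f(\mathbf{b}))$ is always itself a seed of $\mathcal{A}$. $\operatorname{Aut}_{M_n}(\mathcal{S})$ is the group of bijections $\mathcal{S}\to\mathcal{S}$ commuting with the $M_n$-action, acting on the left. Quivers $Q_1,Q_2$ on $I$ are similar, $Q_1\approx Q_2$, if $Q_1$ is obtained from $Q_2$ by reversing all arrows in some (possibly empty) set of connected components. $W^{\mathrm{c}}$ is the subgroup of all $w\in\operatorname{Aut}_{M_n}(\mathcal{S})$ with $Q_{w\cdot x}\approx Q_x$ for all $x\in\mathcal{S}$, and $W^+$ the subgroup of all $w$ with $Q_{w\cdot x}=Q_x$ for all $x\in\mathcal{S}$; the orbits of $W^{\mathrm{c}}$ (resp. $W^+$) on $\mathcal{S}$ are exactly the classes of labelled seeds with similar (resp. equal) quivers. *)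

(* Defs.v *)
From HB Require Import structures.
From mathcomp Require Import all_boot all_order all_fingroup all_algebra.
From mathcomp Require Import generic_quotient fraction mpoly finmap boolp.

Set Implicit Arguments.
Unset Strict Implicit.
Unset Printing Implicit Defensive.

Import Order.TTheory GRing.Theory Num.Theory.
Local Open Scope ring_scope.

Definition group_isomorphism (G H : groupType) (A : {pred G}) (B : {pred H})
    (f : G -> H) : Prop :=
  [/\ group_closed A, group_closed B,
      {in A &, {morph f : u v / (u * v)%g}},
      {in A &, injective f} &
      forall h, h \in B <-> exists2 g, g \in A & f g = h].

Record right_action (G : groupType) (X : Type) := RightAction {
  ract :> X -> G -> X;
  ract1 : forall x, ract x 1%g = x;
  ractM : forall x g h, ract x (g * h)%g = ract (ract x g) h
}.

(** The inverse is part of the data, but is determined by the bijection;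
    equivariance of the inverse follows. *)
Record equiv_aut (G : groupType) (X : Type) (a : right_action G X) := EquivAut {
  ea_fun :> X -> X;
  ea_inv : X -> X;
  ea_funK : cancel ea_fun ea_inv;
  ea_invK : cancel ea_inv ea_fun;
  ea_equiv : forall x g, ea_fun (a x g) = a (ea_fun x) g
}.

Section EquivAutGroup.
Variables (G : groupType) (X : Type) (a : right_action G X).
Implicit Types u v w : equiv_aut a.

Lemma ea_eq u v : u =1 v -> u = v.
Proof.
case: u v => [f fi fK fiK fe] [g gi gK giK ge] /= /funext efg.
move: fK fiK fe; rewrite {}efg => fK fiK fe.
have /funext ei : fi =1 gi by move=> x; rewrite -{1}(giK x) fK.
by move: fK fiK; rewrite {}ei => fK fiK; congr EquivAut.
Qed.

Definition ea_one : equiv_aut a :=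
  @EquivAut _ _ a id id (fun=> erefl) (fun=> erefl) (fun _ _ => erefl).

Lemma ea_mul_equiv u v x g : u (v (a x g)) = a (u (v x)) g.
Proof. by rewrite !ea_equiv. Qed.

Definition ea_mul u v : equiv_aut a :=
  EquivAut (can_comp (@ea_funK _ _ _ u) (@ea_funK _ _ _ v))
    (can_comp (@ea_invK _ _ _ v) (@ea_invK _ _ _ u)) (ea_mul_equiv u v).

Lemma ea_inv_equiv u x g : ea_inv u (a x g) = a (ea_inv u x) g.
Proof. by apply: (can_inj (@ea_funK _ _ _ u)); rewrite ea_equiv !ea_invK. Qed.

Definition ea_inverse u : equiv_aut a :=
  EquivAut (@ea_invK _ _ _ u) (@ea_funK _ _ _ u) (ea_inv_equiv u).

Lemma ea_mulA : associative ea_mul. Proof. by move=> u v w; apply: ea_eq. Qed.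
Lemma ea_mul1 : left_id ea_one ea_mul. Proof. by move=> u; apply: ea_eq. Qed.
Lemma ea_mulr1 : right_id ea_one ea_mul. Proof. by move=> u; apply: ea_eq. Qed.
Lemma ea_mulV : left_inverse ea_one ea_inverse ea_mul.
Proof. by move=> u; apply: ea_eq => x; apply: ea_funK. Qed.
Lemma ea_mulrV : right_inverse ea_one ea_inverse ea_mul.
Proof. by move=> u; apply: ea_eq => x; apply: ea_invK. Qed.

HB.instance Definition _ := gen_eqMixin (equiv_aut a).
HB.instance Definition _ := gen_choiceMixin (equiv_aut a).
HB.instance Definition _ :=
  isGroup.Build (equiv_aut a) ea_mulA ea_mul1 ea_mulr1 ea_mulV ea_mulrV.
End EquivAutGroup.

Record field_iso (K L : fieldType) := FieldIso {
  fi_fun :> K -> L;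
  fi_inv : L -> K;
  fi_add : GRing.zmod_morphism fi_fun;
  fi_mul : GRing.monoid_morphism fi_fun;
  fi_funK : cancel fi_fun fi_inv;
  fi_invK : cancel fi_inv fi_fun
}.

HB.instance Definition _ (K L : fieldType) (f : field_iso K L) :=
  GRing.isZmodMorphism.Build K L (fi_fun f) (fi_add f).
HB.instance Definition _ (K L : fieldType) (f : field_iso K L) :=
  GRing.isMonoidMorphism.Build K L (fi_fun f) (fi_mul f).

Section FieldIso.
Variables K L M : fieldType.

Lemma fi_eq (f g : field_iso K L) : f =1 g -> f = g.
Proof.
case: f g => [f fi fa fm fK fiK] [g gi ga gm gK giK] /= /funext efg.
move: fa fm fK fiK; rewrite {}efg => fa fm fK fiK.
have /funext ei : fi =1 gi by move=> x; rewrite -{1}(giK x) fK.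
by move: fK fiK; rewrite {}ei => fK fiK; congr FieldIso.
Qed.

Definition fi_id : field_iso K K :=
  @FieldIso K K id id (fun _ _ => erefl) (conj erefl (fun _ _ => erefl))
    (fun=> erefl) (fun=> erefl).

Lemma fi_comp_add (g : field_iso L M) (f : field_iso K L) :
  GRing.zmod_morphism (g \o f).
Proof. by move=> x y; rewrite /= !rmorphB. Qed.

Lemma fi_comp_mul (g : field_iso L M) (f : field_iso K L) :
  GRing.monoid_morphism (g \o f).
Proof. by split=> [|x y]; rewrite /= ?rmorph1 ?rmorphM. Qed.

Definition fi_comp (g : field_iso L M) (f : field_iso K L) : field_iso K M :=
  FieldIso (fi_comp_add g f) (fi_comp_mul g f)
    (can_comp (@fi_funK _ _ g) (@fi_funK _ _ f))
    (can_comp (@fi_invK _ _ f) (@fi_invK _ _ g)).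

Lemma fi_inv_add (f : field_iso K L) : GRing.zmod_morphism (fi_inv f).
Proof.
by move=> x y; apply: (can_inj (@fi_funK _ _ f)); rewrite fi_invK (rmorphB f) /= !fi_invK.
Qed.

Lemma fi_inv_mul (f : field_iso K L) : GRing.monoid_morphism (fi_inv f).
Proof.
split=> [|x y]; apply: (can_inj (@fi_funK _ _ f)); rewrite fi_invK.
  by rewrite (rmorph1 f).
by rewrite (rmorphM f) /= !fi_invK.
Qed.

Definition fi_inverse (f : field_iso K L) : field_iso L K :=
  FieldIso (fi_inv_add f) (fi_inv_mul f) (@fi_invK _ _ f) (@fi_funK _ _ f).
End FieldIso.

(** The product of Aut(F) is composition: (f * g) z = f (g z). *)
Definition field_aut (F : fieldType) := field_iso F F.

Section FieldAutGroup.
Variable F : fieldType.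

Lemma fa_mulA : associative (@fi_comp F F F).
Proof. by move=> u v w; apply: fi_eq. Qed.
Lemma fa_mul1 : left_id (fi_id F) (@fi_comp F F F).
Proof. by move=> u; apply: fi_eq. Qed.
Lemma fa_mulr1 : right_id (fi_id F) (@fi_comp F F F).
Proof. by move=> u; apply: fi_eq. Qed.
Lemma fa_mulV : left_inverse (fi_id F) (@fi_inverse F F) (@fi_comp F F F).
Proof. by move=> u; apply: fi_eq => x; apply: fi_funK. Qed.
Lemma fa_mulrV : right_inverse (fi_id F) (@fi_inverse F F) (@fi_comp F F F).
Proof. by move=> u; apply: fi_eq => x; apply: fi_invK. Qed.

HB.instance Definition _ := gen_eqMixin (field_aut F).
HB.instance Definition _ := gen_choiceMixin (field_aut F).
HB.instance Definition _ :=
  isGroup.Build (field_aut F) fa_mulA fa_mul1 fa_mulr1 fa_mulV fa_mulrV.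
End FieldAutGroup.

(** [arr u v] is the multiplicity of the arrow u -> v. *)
Record quiver (V : Type) := Quiver {
  arr :> V -> V -> nat;
  arr_loop : forall u, arr u u = 0%N;
  arr_2cycle : forall u v, (arr u v * arr v u)%N = 0%N
}.

Section Quiver.
Variable V : Type.
Implicit Types Q : quiver V.

Lemma quiver_eq Q1 Q2 : (forall u v, Q1 u v = Q2 u v) -> Q1 = Q2.
Proof.
case: Q1 Q2 => [a al ac] [b bl bc] /= eab.
have {}eab : a = b by apply/funext => u; apply/funext => v.
by move: al ac; rewrite {}eab => al ac; congr Quiver.
Qed.

Definition exch Q (u v : V) : int := (Q u v)%:Z - (Q v u)%:Z.

Definition pos_part (z : int) : nat := if z is Posz m then m else 0%N.

Lemma exchN Q u v : exch Q u v = - exch Q v u.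
Proof. by rewrite /exch opprB. Qed.

Lemma exchK Q u v : pos_part (exch Q u v) = Q u v.
Proof.
rewrite /exch; move/eqP: (arr_2cycle Q u v); rewrite muln_eq0.
case/orP=> /eqP ->; last by rewrite subr0.
by case: (Q v u).
Qed.

Lemma pos_partB (z : int) : (pos_part z)%:Z - (pos_part (- z))%:Z = z.
Proof. by case: z => [[|m]|m]; [ | exact: subr0 | exact: sub0r]. Qed.

Section OfSkew.
Variables (b : V -> V -> int) (bN : forall u v, b u v = - b v u).

Lemma skew_loop u : pos_part (b u u) = 0%N.
Proof.
have : b u u + b u u = 0 by rewrite {1}bN addNr.
by rewrite -mulr2n => /eqP; rewrite mulrn_eq0 /= => /eqP ->.
Qed.

Lemma skew_2cycle u v : (pos_part (b u v) * pos_part (b v u))%N = 0%N.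
Proof. by rewrite (bN v u); case: (b u v) => [[|m]|m] //=; rewrite muln0. Qed.

Definition quiver_of_skew := Quiver skew_loop skew_2cycle.

Lemma exch_of_skew u v : exch quiver_of_skew u v = b u v.
Proof. by rewrite /exch /= (bN v u) pos_partB. Qed.
End OfSkew.

Inductive connected Q : V -> V -> Prop :=
| connected_arr u v : (0 < Q u v)%N -> connected Q u v
| connected_refl u : connected Q u u
| connected_sym u v : connected Q u v -> connected Q v u
| connected_trans u v w : connected Q u v -> connected Q v w -> connected Q u w.

(** [Q1] is [Q2] with all arrows reversed in the union [C] of some connected
    components of [Q2]; [Q2] has no arrows between [C] and its complement. *)
Definition similar Q1 Q2 : Prop :=
  exists C : pred V,
    (forall u v, connected Q2 u v -> C u = C v) /\
    (forall u v, Q1 u v = if C u then Q2 v u else Q2 u v).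
End Quiver.

Section QuiverMutation.
Variables (V : eqType).
Implicit Types (Q : quiver V) (i j k : V).

Definition mut_mx Q i j k : int :=
  if (j == i) || (k == i) then - exch Q j k
  else exch Q j k + (Q j i * Q i k)%N%:Z - (Q k i * Q i j)%N%:Z.

Lemma mut_mxN Q i j k : mut_mx Q i j k = - mut_mx Q i k j.
Proof.
rewrite /mut_mx orbC; case: ifP => _; first by rewrite exchN.
by rewrite (exchN Q j k) !opprD !opprK addrAC.
Qed.

Definition mut_quiver Q i : quiver V := quiver_of_skew (mut_mxN Q i).

Lemma exch_mut Q i j k : exch (mut_quiver Q i) j k = mut_mx Q i j k.
Proof. exact: exch_of_skew. Qed.

Lemma mut_quiver_out Q i k : mut_quiver Q i i k = Q k i.
Proof. by rewrite /= /mut_mx eqxx /= -exchN exchK. Qed.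

Lemma mut_quiver_in Q i k : mut_quiver Q i k i = Q i k.
Proof. by rewrite /= /mut_mx eqxx orbT /= -exchN exchK. Qed.

Lemma mut_quiverK Q i : mut_quiver (mut_quiver Q i) i = Q.
Proof.
apply: quiver_eq => j k; rewrite -[RHS]exchK /=; congr pos_part.
rewrite /mut_mx exch_mut !mut_quiver_in !mut_quiver_out /mut_mx.
case: (_ || _); first exact: opprK.
by rewrite (mulnC (Q i j)) (mulnC (Q i k)) subrK addrK.
Qed.
End QuiverMutation.

Section QuiverPullback.
Variables (U V : Type) (h : U -> V) (Q : quiver V).

Definition pull_quiver : quiver U :=
  @Quiver U (fun u v => Q (h u) (h v)) (fun u => arr_loop Q (h u))
    (fun u v => arr_2cycle Q (h u) (h v)).
End QuiverPullback.

Definition algebraically_independent n (F : fieldType) (b : 'I_n -> F) : Prop :=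
  forall p : {mpoly rat[n]}, mmap (@ratr F) b p = 0 -> p = 0.

(** The only subfield of [F] containing all [b i] is [F] itself. *)
Definition generates_field n (F : fieldType) (b : 'I_n -> F) : Prop :=
  forall P : {pred F}, divring_closed P -> (forall i, b i \in P) ->
  forall z, z \in P.

(** As [ratr] is total, algebraic independence already forces characteristic 0:
    in characteristic p, [ratr p%:R^-1 = 0]. *)
Definition freely_generates n (F : fieldType) (b : 'I_n -> F) : Prop :=
  algebraically_independent b /\ generates_field b.

Definition purely_transcendental n (F : fieldType) : Prop :=
  [pchar F] =i pred0 /\ exists b : 'I_n -> F, freely_generates b.

Section Pchar0.
Variable F : fieldType.
Hypothesis F0 : [pchar F] =i pred0.

Lemma intr_neq0 (z : int) : z != 0 -> z%:~R != 0 :> F.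
Proof.
have nat_neq0 k : k.+1%:R != 0 :> F by rewrite ((pcharf0P F).1 F0).
by case: z => [[|k]|k] // _; rewrite ?NegzE ?mulrNz ?oppr_eq0; apply: nat_neq0.
Qed.

Lemma ratr_eq (q : rat) (a b : int) :
  b != 0 -> q * b%:~R = a%:~R -> ratr q * b%:~R = a%:~R :> F.
Proof.
move=> b0 qb; have d0 : (denq q)%:~R != 0 :> F by rewrite intr_neq0 ?denq_neq0.
rewrite /ratr mulrAC; apply: (canLR (mulfK d0)).
rewrite -!intrM; congr (_%:~R); apply/eqP; rewrite -(eqr_int rat) !intrM -qb.
by rewrite numqE mulrAC.
Qed.

Lemma ratr_pchar0_add : GRing.zmod_morphism (@ratr F).
Proof.
move=> x y; have dx := denq_neq0 x; have dy := denq_neq0 y.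
have dxy : denq x * denq y != 0 by rewrite mulf_neq0.
apply: (mulIf (intr_neq0 dxy)).
rewrite (@ratr_eq _ (numq x * denq y - numq y * denq x)) //; last first.
  by rewrite mulrzBr !intrM !numqE mulrBl !mulrA (mulrAC y).
rewrite mulrzBr !intrM mulrBl; congr (_ - _).
  by rewrite mulrA (@ratr_eq _ (numq x)) ?numqE.
by rewrite (mulrC (denq x)%:~R) mulrA (@ratr_eq _ (numq y)) ?numqE.
Qed.

Lemma ratr_pchar0_mul : GRing.monoid_morphism (@ratr F).
Proof.
split=> [|x y]; first by rewrite /ratr divr1.
have dx := denq_neq0 x; have dy := denq_neq0 y.
have dxy : denq x * denq y != 0 by rewrite mulf_neq0.
apply: (mulIf (intr_neq0 dxy)).
rewrite (@ratr_eq _ (numq x * numq y)) //; last by rewrite !intrM !numqE mulrACA.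
rewrite !intrM mulrACA (@ratr_eq _ (numq x)) ?numqE //.
by rewrite (@ratr_eq _ (numq y)) ?numqE.
Qed.

Definition ratr_morph : {rmorphism rat -> F} :=
  HB.pack (@ratr F)
    (GRing.isZmodMorphism.Build rat F (@ratr F) ratr_pchar0_add)
    (GRing.isMonoidMorphism.Build rat F (@ratr F) ratr_pchar0_mul).
End Pchar0.

Lemma algind_pchar0 n (F : fieldType) (b : 'I_n -> F) :
  algebraically_independent b -> [pchar F] =i pred0.
Proof.
move=> bI p; apply/negbTE/negP => pF.
have p_pr := pcharf_prime pF; have p0 := pcharf0 pF.
have q0 : (p%:R : rat)^-1 != 0.
  by rewrite invr_eq0 pnatr_eq0 -lt0n prime_gt0.
have : ((p%:R : rat)^-1)%:MP_[n] = 0.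
  apply: bI; rewrite /mmap msuppC (negbTE q0) big_seq1 mmap11 mulr1 mcoeffC eqxx mulr1.
  apply/eqP; rewrite /ratr mulf_eq0 invr_eq0; apply/orP; right.
  have -> : denq (p%:R : rat)^-1 = p%:Z * numq (p%:R : rat)^-1.
    apply: (@intr_inj rat); rewrite intrM numqE mulrA -pmulrn mulfV ?mul1r //.
    by rewrite -invr_eq0.
  by rewrite intrM -pmulrn p0 mul0r.
by move/eqP; rewrite mpolyC_eq0 (negbTE q0).
Qed.

Section Eval.
Variables (n : nat) (F : fieldType) (F0 : [pchar F] =i pred0).
Implicit Types (b : 'I_n -> F) (p q : {mpoly rat[n]}).

(** Convertible to [mmap (@ratr F) b]. *)
Definition ev b : {rmorphism {mpoly rat[n]} -> F} := mmap (ratr_morph F0) b.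

Lemma evX b i : ev b 'X_i = b i.
Proof. by rewrite -[LHS]/(mmap (ratr_morph F0) b 'X_i) mmapX mmap1U. Qed.

Lemma evC b c : ev b c%:MP = ratr c.
Proof. exact: mmapC. Qed.

Lemma ev_ext b b' p : b =1 b' -> ev b p = ev b' p.
Proof. by move=> /funext ->. Qed.

Lemma mpoly_alg_ind (P : {mpoly rat[n]} -> Prop) :
  (forall c, P c%:MP) -> (forall i, P 'X_i) ->
  (forall p q, P p -> P q -> P (p + q)) ->
  (forall p q, P p -> P q -> P (p * q)) -> forall p, P p.
Proof.
move=> PC PX PD PM; apply: mpolyind => [|c m p _ _ Pp]; first by rewrite -mpolyC0.
apply: (PD) => //; rewrite -mul_mpolyC; apply: (PM) => //.
rewrite (mpolyXE _ 1%g); apply: big_ind => [||i _]; [by rewrite -mpolyC1|exact: (PM)|].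
rewrite perm1; elim: (m i) => [|k IHk]; first by rewrite expr0 -mpolyC1.
by rewrite exprS; apply: (PM).
Qed.

End Eval.

Section Cluster.
Variables (n : nat) (F : fieldType).
Implicit Types (Q : quiver 'I_n) (b : {ffun 'I_n -> F}).

Definition exch_num Q b i : F := \prod_k b k ^+ Q k i + \prod_k b k ^+ Q i k.

Definition mut_cluster Q b i : {ffun 'I_n -> F} :=
  [ffun j => if j == i then exch_num Q b i / b i else b j].

Definition perm_cluster b (s : 'S_n) : {ffun 'I_n -> F} := [ffun i => b (s i)].

Lemma eq_exch_num Q b b' i : (forall k, k != i -> b k = b' k) ->
  exch_num Q b i = exch_num Q b' i.
Proof.
move=> e; congr (_ + _); apply: eq_bigr => k _; have [->|/e -> //] := eqVneq k i;
  by rewrite arr_loop.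
Qed.

Lemma exch_num_mut Q b i : exch_num Q (mut_cluster Q b i) i = exch_num Q b i.
Proof. by apply: eq_exch_num => k /negbTE ki; rewrite ffunE ki. Qed.

Lemma exch_num_mutq Q b i : exch_num (mut_quiver Q i) b i = exch_num Q b i.
Proof.
by rewrite /exch_num addrC; congr (_ + _); apply: eq_bigr => k _;
  rewrite ?mut_quiver_in ?mut_quiver_out.
Qed.

Lemma algind_neq0 b i : algebraically_independent b -> b i != 0.
Proof.
move=> bI; have F0 := algind_pchar0 bI; apply/eqP => bi0.
have /bI/(congr1 (meval (fun=> 1 : rat)))/eqP : ev F0 b 'X_i = 0 by rewrite evX.
by rewrite mevalXU raddf0 oner_eq0.
Qed.

Definition exch_poly Q i : {mpoly rat[n]} :=
  \prod_k 'X_k ^+ Q k i + \prod_k 'X_k ^+ Q i k.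

Lemma ev_exch_poly F0 Q b i : ev F0 b (exch_poly Q i) = exch_num Q b i.
Proof.
by rewrite rmorphD !rmorph_prod; congr (_ + _); apply: eq_bigr => k _;
  rewrite rmorphXn /= -[mmap _ _ _]/(ev F0 b 'X_k) evX.
Qed.

Lemma exch_num_neq0 Q b i : algebraically_independent b -> exch_num Q b i != 0.
Proof.
move=> bI; have F0 := algind_pchar0 bI; apply/eqP => e0.
have /bI/(congr1 (meval (fun=> 1 : rat))) : ev F0 b (exch_poly Q i) = 0.
  by rewrite ev_exch_poly.
rewrite rmorph0 rmorphD !rmorph_prod !big1 => [//|k _|k _];
  by rewrite rmorphXn /= mevalXU expr1n.
Qed.

Lemma mut_cluster_mutq Q b i : mut_cluster (mut_quiver Q i) b i = mut_cluster Q b i.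
Proof. by apply/ffunP => j; rewrite !ffunE exch_num_mutq. Qed.

Lemma mut_clusterK Q b i : algebraically_independent b ->
  mut_cluster (mut_quiver Q i) (mut_cluster Q b i) i = b.
Proof.
move=> bI; apply/ffunP => j; rewrite ffunE exch_num_mutq exch_num_mut !ffunE eqxx.
case: eqP => [->|_ //].
by rewrite invf_div mulrCA divff ?mulr1 // exch_num_neq0.
Qed.

Lemma mut_cluster_algind Q b i :
  algebraically_independent b -> algebraically_independent (mut_cluster Q b i).
Proof.
move=> bI; have F0 := algind_pchar0 bI => p pb'0.
have [q [d Hq]] : exists q : {mpoly rat[n]}, exists d, forall g : {ffun 'I_n -> F},
    g i != 0 -> ev F0 g q = g i ^+ d * ev F0 (mut_cluster Q g i) p.
  elim/mpoly_alg_ind: p {pb'0} => [c|j|p1 p2 [q1 [d1 H1]] [q2 [d2 H2]]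
      |p1 p2 [q1 [d1 H1]] [q2 [d2 H2]]].
  - by exists c%:MP, 0%N => g _; rewrite !evC expr0 mul1r.
  - have [->|ji] := eqVneq j i.
      exists (exch_poly Q i), 1%N => g gi.
      by rewrite ev_exch_poly evX ffunE eqxx expr1 mulrCA divff // mulr1.
    by exists 'X_j, 0%N => g _; rewrite !evX ffunE (negbTE ji) expr0 mul1r.
  - exists ('X_i ^+ d2 * q1 + 'X_i ^+ d1 * q2), (d1 + d2)%N => g gi.
    rewrite rmorphD !(rmorphM (ev F0 g)) !(rmorphXn (ev F0 g)) evX H1 // H2 //.
    rewrite (rmorphD (ev F0 (mut_cluster Q g i))) mulrDr exprD !mulrA.
    by rewrite (mulrC (g i ^+ d2)).
  - exists (q1 * q2), (d1 + d2)%N => g gi.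
    rewrite !(rmorphM (ev F0 g)) H1 // H2 //.
    by rewrite (rmorphM (ev F0 (mut_cluster Q g i))) exprD mulrACA.
have q0 : q = 0.
  by apply: (bI); apply: (etrans (Hq b (algind_neq0 i bI))); 
    rewrite -[X in _ * X]/(mmap (@ratr F) (mut_cluster Q b i) p) pb'0 mulr0.
have b'i : mut_cluster Q b i i != 0.
  by rewrite ffunE eqxx mulf_neq0 ?invr_eq0 ?exch_num_neq0 ?algind_neq0.
have := Hq _ b'i; rewrite q0 rmorph0 => /esym/eqP.
rewrite mulf_eq0 expf_eq0 (negbTE b'i) andbF /= => /eqP pb0.
apply: (bI); rewrite -[LHS]/(ev F0 b p) -[RHS]pb0; apply: ev_ext => j.
by rewrite -mut_cluster_mutq mut_clusterK.
Qed.

Lemma mut_cluster_gen Q b i : freely_generates b ->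
  generates_field (mut_cluster Q b i).
Proof.
move=> [bI bG] P Pc Pb; apply: (bG P Pc).
have [P1 PB Pd] := Pc.
have PM u v : u \in P -> v \in P -> u * v \in P.
  by move=> Pu Pv; rewrite -[v]invrK -[v^-1]div1r; apply: (Pd) => //; apply: Pd.
have PD u v : u \in P -> v \in P -> u + v \in P.
  move=> Pu Pv; rewrite -[v]opprK -[- v]sub0r; apply: (PB) => //.
  by apply: (PB) => //; rewrite -(subrr 1); apply: PB.
have PX u k : u \in P -> u ^+ k \in P.
  by move=> Pu; elim: k => [|k IHk]; rewrite ?expr0 ?exprS ?PM.
move=> j; have := Pb j; rewrite ffunE; case: eqP => [->|//] Pi.
have -> : b i = exch_num Q (mut_cluster Q b i) i / mut_cluster Q b i i.
  by rewrite -[in LHS](mut_clusterK Q i bI) ffunE eqxx exch_num_mutq.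
apply: Pd (Pb i); apply: PD; apply: (big_ind (fun u => u \in P)) => // k _; exact: PX.
Qed.

Lemma mut_cluster_free Q b i :
  freely_generates b -> freely_generates (mut_cluster Q b i).
Proof. by move=> bF; split; [exact: mut_cluster_algind bF.1|exact: mut_cluster_gen]. Qed.

Lemma perm_cluster_free b s : freely_generates b -> freely_generates (perm_cluster b s).
Proof.
move=> [bI bG]; split=> [p pb0|P Pc Pb]; last first.
  by apply: bG Pc _ => i; have := Pb (s^-1 i)%g; rewrite ffunE permKV.
have F0 := algind_pchar0 bI.
have E q : ev F0 b (msym s q) = ev F0 (perm_cluster b s) q.
  elim/mpoly_alg_ind: q => [c|i|q1 q2 e1 e2|q1 q2 e1 e2].
  - by rewrite /msym mmapC !evC.
  - by rewrite /msym mmapX mmap1U !evX ffunE.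
  - by rewrite !rmorphD /= -!/(ev _ _ _) e1 e2.
  - by rewrite !rmorphM /= e1 e2.
apply: (inj_msym s); rewrite msym0; apply: bI.
by rewrite -[LHS]/(ev F0 b _) E.
Qed.
End Cluster.

Notation ratfun n := {fraction {mpoly rat[n]}}.

Lemma fracE (R : idomainType) (z : {fraction R}) :
  z = tofrac \n_(repr z) / tofrac \d_(repr z).
Proof.
apply: (canRL (mulfK _)); first by rewrite tofrac_eq0 denom_ratioP.
rewrite -{1}[z](@reprK _ {fraction R}) /tofrac; unlock FracField.tofrac.
rewrite -[LHS]FracField.pi_mul; apply/eqmodP; rewrite /= FracField.equivfE /=.
rewrite /FracField.mulf /= !numden_Ratio ?(oner_neq0, mulr1, mul1r, denom_ratioP) //.
by rewrite mulrC.
Qed.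

Section ClusterIso.
Variables (n : nat) (F : fieldType) (b : 'I_n -> F).
Hypothesis bF : freely_generates b.

Let F0 := algind_pchar0 bF.1.

Definition eval_at (z : ratfun n) : F :=
  mmap (@ratr F) b \n_(repr z) / mmap (@ratr F) b \d_(repr z).

Let ev_neq0 p : p != 0 -> ev F0 b p != 0.
Proof. by apply: contraNneq => /bF.1 ->. Qed.

Lemma eval_atE (p q : {mpoly rat[n]}) : q != 0 ->
  eval_at (tofrac p / tofrac q) = ev F0 b p / ev F0 b q.
Proof.
move=> q0; set z := _ / _; have := fracE z; rewrite {1}/z => /eqP.
have d0 : \d_(repr z) != 0 by exact: denom_ratioP.
rewrite eqr_div ?tofrac_eq0 // -!tofracM tofrac_eq => /eqP e.
apply/eqP; rewrite /eval_at -!/(ev F0 b _) eqr_div ?ev_neq0 //.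
by rewrite -!(rmorphM (ev F0 b)) -e mulrC.
Qed.

Lemma eval_at_add : GRing.zmod_morphism eval_at.
Proof.
move=> x y; rewrite {1}(fracE x) {1}(fracE y).
have dx : \d_(repr x) != 0 by exact: denom_ratioP.
have dy : \d_(repr y) != 0 by exact: denom_ratioP.
rewrite -mulNr addf_div ?tofrac_eq0 // -tofracN -!tofracM -tofracD.
rewrite eval_atE ?mulf_neq0 // rmorphD !(rmorphM (ev F0 b)) rmorphN.
by rewrite -addf_div ?ev_neq0 // mulNr.
Qed.

Lemma eval_at_mul : GRing.monoid_morphism eval_at.
Proof.
split=> [|x y].
  by rewrite -[1]divr1 -tofrac1 eval_atE ?oner_neq0 // rmorph1 divr1.
rewrite {1}(fracE x) {1}(fracE y) mulf_div -!tofracM eval_atE ?mulf_neq0 ?denom_ratioP //.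
by rewrite !(rmorphM (ev F0 b)) -mulf_div.
Qed.

Let eval_morph : {rmorphism ratfun n -> F} :=
  HB.pack eval_at
    (GRing.isZmodMorphism.Build (ratfun n) F eval_at eval_at_add)
    (GRing.isMonoidMorphism.Build (ratfun n) F eval_at eval_at_mul).

Lemma eval_atX i : eval_at (tofrac 'X_i) = b i.
Proof.
rewrite -[tofrac _]divr1 -tofrac1 eval_atE ?oner_neq0 //.
by rewrite rmorph1 divr1 evX.
Qed.

Lemma eval_at_surj y : exists z, eval_at z == y.
Proof.
suff: y \in [pred u | `[< exists z, eval_at z == u >]] by move/asboolP.
apply: bF.2 => [|i]; last by apply/asboolP; exists (tofrac 'X_i); rewrite eval_atX.
split=> [|u v|u v].
- by apply/asboolP; exists 1; apply/eqP; exact: (rmorph1 eval_morph).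
- move=> /asboolP[z1 /eqP<-] /asboolP[z2 /eqP<-]; apply/asboolP.
  by exists (z1 - z2); apply/eqP; exact: (rmorphB eval_morph).
- move=> /asboolP[z1 /eqP<-] /asboolP[z2 /eqP<-]; apply/asboolP.
  by exists (z1 / z2); apply/eqP; exact: (fmorph_div eval_morph).
Qed.

Definition coord_of (y : F) : ratfun n := xchoose (eval_at_surj y).

Lemma coord_ofK : cancel coord_of eval_at.
Proof. by move=> y; apply/eqP; exact: (xchooseP (eval_at_surj y)). Qed.

Lemma eval_atK : cancel eval_at coord_of.
Proof. by move=> z; apply: (fmorph_inj eval_morph); apply: coord_ofK. Qed.

Definition cluster_iso : field_iso (ratfun n) F :=
  FieldIso eval_at_add eval_at_mul eval_atK coord_ofK.

Lemma cluster_isoX i : cluster_iso (tofrac 'X_i) = b i.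
Proof. exact: eval_atX. Qed.
End ClusterIso.

Section MutationGroup.
Variable n : nat.
Implicit Types (u v w : seq 'I_n) (i j : 'I_n) (s t : 'S_n).

Definition reduced w := sorted (fun i j => i != j) w.

(** Left multiplication by mu_i, and product, on reduced words in the free
    product <mu_1, ..., mu_n : mu_i^2 = 1>. *)
Definition red_cons i w :=
  if w is j :: w' then if i == j then w' else i :: w else [:: i].
Definition red_cat u v := foldr red_cons v u.

Lemma red_cons_reduced i w : reduced w -> reduced (red_cons i w).
Proof.
case: w => [|j w] //= Rw; case: eqP => [_|/eqP ij]; first exact: path_sorted Rw.
by rewrite /reduced /= ij.
Qed.

Lemma red_cons_path i w : reduced (i :: w) -> red_cons i w = i :: w.
Proof. by case: w => [|j w] //= /andP[/negbTE->]. Qed.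

Lemma red_consK i w : reduced w -> red_cons i (red_cons i w) = w.
Proof.
case: w => [|j w] Rw /=; first by rewrite eqxx.
by case: eqP => [->|_]; [exact: red_cons_path|rewrite /= eqxx].
Qed.

Lemma red_cat_reduced u v : reduced v -> reduced (red_cat u v).
Proof. by move=> Rv; elim: u => //= i u; apply: red_cons_reduced. Qed.

Lemma red_cat_cons i u v : reduced v ->
  red_cat (red_cons i u) v = red_cons i (red_cat u v).
Proof.
case: u => [|j u] //= Rv; case: eqP => [->|//].
by rewrite red_consK // red_cat_reduced.
Qed.

Lemma red_catA u v w : reduced w ->
  red_cat u (red_cat v w) = red_cat (red_cat u v) w.
Proof. by move=> Rw; elim: u => //= i u ->; rewrite red_cat_cons. Qed.

Lemma red_cat0 u : reduced u -> red_cat u [::] = u.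
Proof.
elim: u => //= i u IHu Ru; rewrite IHu ?red_cons_path //; exact: path_sorted Ru.
Qed.

Lemma red_catK u w : reduced w -> red_cat (rev u) (red_cat u w) = w.
Proof.
move=> Rw; elim: u => //= i u IHu.
by rewrite rev_cons /red_cat foldr_rcons red_consK // red_cat_reduced.
Qed.

Lemma red_catV u : reduced u -> red_cat (rev u) u = [::].
Proof. by move=> Ru; have := @red_catK u [::] isT; rewrite red_cat0. Qed.

Lemma map_red_cat s u v : map s (red_cat u v) = red_cat (map s u) (map s v).
Proof.
elim: u => //= i u <-; case: (red_cat u v) => //= j w.
by rewrite (inj_eq perm_inj); case: eqP.
Qed.

Lemma map_reduced s u : reduced u -> reduced (map s u).
Proof.
rewrite /reduced sorted_map; apply: sub_sorted => i j /=.
by rewrite (inj_eq perm_inj).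
Qed.

Lemma rev_reduced u : reduced u -> reduced (rev u).
Proof.
by rewrite /reduced rev_sorted; apply: sub_sorted => i j; rewrite eq_sym.
Qed.

(** The pair (s, w) stands for the product s w, in S_n |>< <mu_i>. *)
Record mutation_group := MutGroup {
  mg_perm : 'S_n;
  mg_word : seq 'I_n;
  mg_reduced : reduced mg_word
}.
Implicit Types g h k : mutation_group.

Lemma mg_eq g h : mg_perm g = mg_perm h -> mg_word g = mg_word h -> g = h.
Proof.
case: g h => [s u Ru] [t v Rv] /= est euv.
by move: Ru Rv; rewrite est euv => Ru Rv; congr MutGroup; apply: bool_irrelevance.
Qed.

(** From mu_i t = t mu_(t^-1 i), one gets
    (s u) (t v) = (s t) (t^-1(u) v). The product s t of S_n is composition of
    functions, i |-> s (t i), which is [(t * s)%g] in the library. *)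
Lemma mg_mul_reduced g h :
  reduced (red_cat (map (mg_perm h)^-1%g (mg_word g)) (mg_word h)).
Proof. exact/red_cat_reduced/mg_reduced. Qed.

Definition mg_mul g h : mutation_group :=
  @MutGroup (mg_perm h * mg_perm g)%g _ (mg_mul_reduced g h).

Definition mg_one : mutation_group := @MutGroup 1%g [::] isT.

Definition mg_inv g : mutation_group :=
  @MutGroup (mg_perm g)^-1%g _
    (map_reduced (mg_perm g) (rev_reduced (mg_reduced g))).

Lemma mg_mulA : associative mg_mul.
Proof.
move=> g h k; apply: mg_eq => /=; first by rewrite mulgA.
rewrite map_red_cat -red_catA ?mg_reduced // -map_comp; congr red_cat.
by apply: eq_map => i; rewrite /= invMg permM.
Qed.

Lemma mg_mul1 : left_id mg_one mg_mul.
Proof. by move=> g; apply: mg_eq => //=; rewrite mulg1. Qed.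

Lemma mg_mulr1 : right_id mg_one mg_mul.
Proof.
move=> g; apply: mg_eq => /=; first by rewrite mul1g.
rewrite red_cat0; last exact/map_reduced/mg_reduced.
by rewrite -[RHS]map_id; apply: eq_map => i; rewrite invg1 perm1.
Qed.

Lemma mg_mulV : left_inverse mg_one mg_inv mg_mul.
Proof.
move=> g; apply: mg_eq => /=; first by rewrite mulgV.
rewrite -map_comp (eq_map (g := id)) => [|i]; last by rewrite /= permK.
by rewrite map_id red_catV ?mg_reduced.
Qed.

Lemma mg_mulrV : right_inverse mg_one mg_inv mg_mul.
Proof.
move=> g; apply: mg_eq => /=; first by rewrite mulVg.
rewrite invgK -map_red_cat -[X in red_cat X](revK (mg_word g)).
by rewrite red_catV // rev_reduced ?mg_reduced.
Qed.

HB.instance Definition _ := gen_eqMixin mutation_group.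
HB.instance Definition _ := gen_choiceMixin mutation_group.
HB.instance Definition _ := isGroup.Build mutation_group
  mg_mulA mg_mul1 mg_mulr1 mg_mulV mg_mulrV.
End MutationGroup.

Record lseed n (F : fieldType) := LSeed {
  quiver_of : quiver 'I_n;
  cluster : {ffun 'I_n -> F};
  cluster_free : freely_generates cluster
}.

Section LabelledSeeds.
Variables (n : nat) (F : fieldType).
Implicit Types (x y : lseed n F) (s t : 'S_n) (g h : mutation_group n).

Lemma lseed_eq x y : quiver_of x = quiver_of y -> cluster x = cluster y -> x = y.
Proof.
case: x y => [Q b bF] [R c cF] /= eQ ec.
by move: bF cF; rewrite eQ ec => bF cF; congr LSeed; apply: Prop_irrelevance.
Qed.

Definition mutate x (i : 'I_n) : lseed n F :=
  @LSeed n F (mut_quiver (quiver_of x) i) _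
    (mut_cluster_free (quiver_of x) i (cluster_free x)).

Definition relabel x s : lseed n F :=
  @LSeed n F (pull_quiver s (quiver_of x)) _
    (perm_cluster_free s (cluster_free x)).

Definition seed_act x g : lseed n F :=
  foldl mutate (relabel x (mg_perm g)) (mg_word g).

Lemma mutateK i : involutive (mutate^~ i).
Proof.
move=> x; apply: lseed_eq => /=; first exact: mut_quiverK.
exact: mut_clusterK (cluster_free x).1.
Qed.

Lemma relabelM x s t : relabel (relabel x s) t = relabel x (t * s)%g.
Proof.
apply: lseed_eq => /=; first by apply: quiver_eq => i j /=; rewrite !permM.
by apply/ffunP => i; rewrite !ffunE permM.
Qed.

Lemma relabel_mutate x s i :
  relabel (mutate x i) s = mutate (relabel x s) (s^-1 i)%g.
Proof.
have es j : (j == (s^-1 i)%g) = (s j == i) by rewrite (can2_eq (permK s) (permKV s)).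
apply: lseed_eq => /=.
  by apply: quiver_eq => j k /=; rewrite /mut_mx /= !es permKV.
apply/ffunP => j; rewrite !ffunE es permKV; case: eqP => // _; congr (_ / _).
by congr (_ + _); rewrite (reindex_inj (@perm_inj _ s)); apply: eq_bigr => k _;
  rewrite /= ffunE permKV.
Qed.

Lemma relabel_foldl x s (u : seq 'I_n) :
  relabel (foldl mutate x u) s = foldl mutate (relabel x s) (map s^-1%g u).
Proof. by elim: u x => //= i u IHu x; rewrite IHu relabel_mutate. Qed.

Lemma foldl_red_cat x (u v : seq 'I_n) :
  foldl mutate x (red_cat u v) = foldl mutate (foldl mutate x u) v.
Proof.
elim: u x => //= i u IHu x; rewrite -IHu.
by case: (red_cat u v) => //= j w; case: eqP => // <-; rewrite mutateK.
Qed.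

Lemma seed_act1 x : seed_act x 1%g = x.
Proof.
apply: lseed_eq => /=; first by apply: quiver_eq => i j /=; rewrite !perm1.
by apply/ffunP => i; rewrite ffunE perm1.
Qed.

Lemma seed_actM x g h : seed_act x (g * h)%g = seed_act (seed_act x g) h.
Proof. by rewrite /seed_act relabel_foldl relabelM foldl_red_cat. Qed.

(** [x] regarded as the isomorphism K -> F, x_i |-> beta_i. *)
Definition seed_iso x : field_iso (ratfun n) F := cluster_iso (cluster_free x).

Lemma seed_isoX x i : seed_iso x (tofrac 'X_i) = cluster x i.
Proof. exact: cluster_isoX. Qed.
End LabelledSeeds.

Record mutation_class n (F : fieldType) := MutationClass {
  in_class :> lseed n F -> Prop;
  in_class_orbit : exists x, forall y, in_class y <-> exists g, y = seed_act x g
}.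

Section MutationClass.
Variables (n : nat) (F : fieldType) (S : mutation_class n F).

Definition mseed : Type := {x : lseed n F | S x}.

Lemma in_class_act x g : S x -> S (seed_act x g).
Proof.
have [x0 Sx0] := in_class_orbit S.
move=> /Sx0[h ->]; apply/Sx0; exists (h * g)%g.
by rewrite seed_actM.
Qed.

Definition mseed_act (x : mseed) (g : mutation_group n) : mseed :=
  exist _ (seed_act (sval x) g) (in_class_act g (svalP x)).

Lemma mseed_eq (x y : mseed) : sval x = sval y -> x = y.
Proof.
case: x y => [x Sx] [y Sy] /= exy; move: Sx Sy; rewrite exy => Sx Sy.
by congr exist; apply: Prop_irrelevance.
Qed.

Lemma mseed_act1 x : mseed_act x 1%g = x.
Proof. exact/mseed_eq/seed_act1. Qed.

Lemma mseed_actM x g h : mseed_act x (g * h)%g = mseed_act (mseed_act x g) h.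
Proof. exact/mseed_eq/seed_actM. Qed.

Definition mseed_action : right_action (mutation_group n) mseed :=
  RightAction mseed_act1 mseed_actM.

Definition mclass_aut : groupType := equiv_aut mseed_action.

Definition Wc : {pred mclass_aut} :=
  [pred w : equiv_aut mseed_action | `[< forall x : mseed,
     similar (quiver_of (sval (w x))) (quiver_of (sval x)) >]].

Definition Wplus : {pred mclass_aut} :=
  [pred w : equiv_aut mseed_action | `[< forall x : mseed,
     quiver_of (sval (w x)) = quiver_of (sval x) >]].

(** alpha_w = beta_(w x) o beta_x^-1, computed at [x]. *)
Definition alpha (x : mseed) (w : mclass_aut) : field_aut F :=
  fi_comp (seed_iso (sval ((w : equiv_aut mseed_action) x)))
    (fi_inverse (seed_iso (sval x))).
End MutationClass.

Arguments Wc {n F} S.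
Arguments Wplus {n F} S.

Local Open Scope fset_scope.

(** A quiver with vertex set [uset] is encoded as a quiver on [F] all of whose
    arrows are between elements of [uset]. *)
Record useed n (F : fieldType) := USeed {
  uset : {fset F};
  uquiver : quiver F;
  usupport : forall u v, (0 < uquiver u v)%N -> u \in uset /\ v \in uset;
  uset_free : exists2 b : {ffun 'I_n -> F},
    freely_generates b & uset = [fset b i | i : 'I_n]
}.

Section UnlabelledSeeds.
Variables (n : nat) (F : fieldType).
Implicit Types (x : lseed n F) (s t : useed n F) (f : field_aut F).

(** Vertex i is replaced by beta_i; the beta_i are distinct, so each [pick]
    has at most one candidate. *)
Definition unlabel_arr x (u v : F) : nat :=
  match [pick i | cluster x i == u], [pick j | cluster x j == v] with
  | Some i, Some j => quiver_of x i j
  | _, _ => 0%N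
  end.

Lemma unlabel_loop x u : unlabel_arr x u u = 0%N.
Proof. by rewrite /unlabel_arr; case: pickP => // i _; apply: arr_loop. Qed.

Lemma unlabel_2cycle x u v : (unlabel_arr x u v * unlabel_arr x v u)%N = 0%N.
Proof.
rewrite /unlabel_arr; case: pickP => // i _; case: pickP => // j _.
exact: arr_2cycle.
Qed.

Definition unlabel_quiver x : quiver F :=
  Quiver (unlabel_loop x) (unlabel_2cycle x).

Lemma unlabel_support x u v : (0 < unlabel_quiver x u v)%N ->
  u \in [fset cluster x i | i : 'I_n] /\ v \in [fset cluster x i | i : 'I_n].
Proof.
rewrite /= /unlabel_arr; case: pickP => // i /eqP <-; case: pickP => // j /eqP <- _.
by rewrite !in_imfset.
Qed.

Definition unlabel x : useed n F :=
  USeed (@unlabel_support x)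
    (ex_intro2 _ _ (cluster x) (cluster_free x) erefl).

Lemma free_image f (b : {ffun 'I_n -> F}) :
  freely_generates b -> freely_generates [ffun i => f (b i)].
Proof.
move=> [bI bG]; split=> [p pb0|P [P1 PB PV] Pb z].
  apply: bI; apply: (can_inj (@fi_funK _ _ f)); rewrite rmorph0 -[RHS]pb0.
  rewrite /mmap rmorph_sum; apply: eq_bigr => m _; rewrite rmorphM /= fmorph_rat.
  congr (_ * _); rewrite /mmap1 rmorph_prod; apply: eq_bigr => i _.
  by rewrite rmorphXn ffunE.
rewrite -(fi_invK f z); apply: (bG [pred u | f u \in P]) => [|i]; last first.
  by have := Pb i; rewrite ffunE.
split=> [|u v Pu Pv|u v Pu Pv]; rewrite inE ?rmorph1 ?rmorphB ?fmorph_div //.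
  exact: PB.
exact: PV.
Qed.

Lemma image_support f s u v : (0 < pull_quiver (fi_inv f) (uquiver s) u v)%N ->
  u \in [fset f b | b in uset s] /\ v \in [fset f b | b in uset s].
Proof.
move=> /usupport[us vs].
by rewrite -{1}(fi_invK f u) -{1}(fi_invK f v) !in_imfset.
Qed.

Lemma image_free f s : exists2 b : {ffun 'I_n -> F},
  freely_generates b & [fset f v | v in uset s] = [fset b i | i : 'I_n].
Proof.
have [b bF ->] := uset_free s; exists [ffun i => f (b i)]; first exact: free_image.
apply/fsetP => u; apply/imfsetP/imfsetP => /= [[_ /imfsetP[i _ ->] ->]|[i _ ->]].
  by exists i; rewrite ?ffunE.
by exists (b i); rewrite ?ffunE // in_imfset.
Qed.

(** (Q, b) |-> (Q, f(b)): each vertex v is replaced by f(v). *)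
Definition seed_image f s : useed n F :=
  USeed (@image_support f s) (image_free f s).

Definition useed_similar s t : Prop :=
  uset s = uset t /\ similar (uquiver s) (uquiver t).
End UnlabelledSeeds.

Section ClusterAutomorphisms.
Variables (n : nat) (F : fieldType) (S : mutation_class n F).

(** The seeds of the cluster algebra of [S]. *)
Definition is_seed (s : useed n F) : Prop :=
  exists x : mseed S, s = unlabel (sval x).

(** Aut^c and Aut^+ depend on the cluster algebra only through its seeds. *)
Definition Autc : {pred field_aut F} :=
  [pred f : field_aut F | `[< forall s, is_seed s ->
     exists2 t, is_seed t & useed_similar (seed_image f s) t >]].

Definition Autplus : {pred field_aut F} :=
  [pred f : field_aut F | `[< forall s, is_seed s -> is_seed (seed_image f s) >]].
End ClusterAutomorphisms.

Arguments Autc {n F} S.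
Arguments Autplus {n F} S.

(* Main.v *)
Require Import Defs.
From mathcomp Require Import all_boot all_fingroup all_algebra.
From mathcomp Require Import generic_quotient fraction mpoly finmap boolp ring.

(** The map alpha is injective because, inside one mutation class, a labelled
    seed is determined by its cluster. The reason is a mutation invariant: the
    2-form
      sum_(i, j) b_ij dlog beta_i /\ dlog beta_j,
    attached to a labelled seed (Q, beta), is the same for all seeds of the
    class ([log_form_act]). As the dlog beta_i are linearly independent, a
    cluster and this form together give back the b_ij, hence Q
    ([quiver_of_log_form]). So two elements w of Aut_(M_n)(S) with the same
    alpha_w agree at one seed, and then everywhere, as M_n is transitive on S.
    Instead of differentials, the form is evaluated at pairs of derivations
    of F.

    Everything else rests on two remarks. Applying a field automorphism to the
    cluster of a labelled seed commutes with M_n ([image_lseed_act]). And the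
    relation of having the same cluster and similar quivers is preserved by
    M_n ([same_cluster_similar_act]): the exchange relation at a vertex only
    sees the two monomials at that vertex, which a reversal of arrows either
    fixes or swaps, and reversing whole components commutes with mutation. If
    w is in W^c, then alpha_w(x) and w(x) are so related at the base seed x,
    hence at all seeds; thus alpha_w does not depend on x and is a cluster
    automorphism. Conversely, if f is a cluster automorphism then f(x) is
    so related to some y in S, hence f(x g) to y g for all g in M_n. As a seed
    is determined by its cluster, x g |-> y g is a well defined bijection w
    with alpha_w = f ([lift_field_aut]). For the direct versions, that same w
    preserves quivers, again since seeds are determined by their clusters. *)

Set Implicit Arguments.
Unset Strict Implicit.
Unset Printing Implicit Defensive.

(* In this order, [similar] is the relation on quivers and not the one on
   matrices. *)
Import GRing.Theory Defs.
Local Open Scope ring_scope.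

(** * Derivations of rational function fields *)

Definition derivation (R : nzRingType) (D : R -> R) : Prop :=
  {morph D : u v / u + v} /\ forall u v, D (u * v) = D u * v + u * D v.

(** The quotient rule. A fraction z with z q = p must satisfy
    D z q = d p - z d q; this is taken as the definition for the chosen
    representative, and then shown for every p and q with z q = p. *)
Lemma frac_derivation (R : idomainType) (d : R -> R) : derivation d ->
  exists2 D : {fraction R} -> {fraction R},
    derivation D & forall p, D (tofrac p) = tofrac (d p).
Proof.
move=> [dD dM].
pose D (z : {fraction R}) : {fraction R} :=
  (tofrac (d \n_(repr z)) - z * tofrac (d \d_(repr z))) / tofrac \d_(repr z).
have DE (z : {fraction R}) (p q : R) : q != 0 -> z * tofrac q = tofrac p ->
    D z * tofrac q = tofrac (d p) - z * tofrac (d q).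
  move=> q0 zq; rewrite /D.
  set a := \n_(repr z); set b := \d_(repr z).
  have b0 : tofrac b != 0 by rewrite tofrac_eq0 denom_ratioP.
  have zb : z * tofrac b = tofrac a by rewrite {1}(fracE z) divfK.
  (* Cross multiplying gives an identity in [R], to which [d] applies. *)
  have /eqP : tofrac (q * a) = tofrac (p * b).
    by rewrite !tofracM -zq -zb; ring.
  rewrite tofrac_eq => /eqP/(congr1 d)/(congr1 (@tofrac R)).
  rewrite !dM !tofracD !tofracM -zq -zb => E.
  apply: (mulIf b0); rewrite mulrAC divfK //.
  rewrite !mulrBl; apply/eqP; rewrite subr_eq; apply/eqP.
  transitivity (tofrac (d q) * (z * tofrac b) + tofrac q * tofrac (d a)
    - z * tofrac b * tofrac (d q)); first by ring.
  by rewrite E; ring.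
have D1 (z w : {fraction R}) (q : R) : q != 0 -> w * tofrac q = z * tofrac q -> w = z.
  by move=> q0; apply: mulIf; rewrite tofrac_eq0.
exists D; last first.
  move=> p; apply: (D1 _ _ 1); first exact: oner_neq0.
  have d1 : d 1 = 0.
    by apply: (@addrI _ (d 1)); rewrite addr0 -{3}(mulr1 1) dM mulr1 mul1r.
  by rewrite (DE _ p) ?oner_neq0 ?tofrac1 ?mulr1 // d1 tofrac0 mulr0 subr0.
have frac (z : {fraction R}) : exists p, exists2 q, q != 0 & z * tofrac q = tofrac p.
  exists \n_(repr z), \d_(repr z); first exact: denom_ratioP.
  by rewrite {1}(fracE z) divfK // tofrac_eq0 denom_ratioP.
split=> x y; have [p [q q0 xq]] := frac x; have [r [s s0 ys]] := frac y;
  have qs0 := mulf_neq0 q0 s0; apply: (D1 _ _ _ qs0);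
  have Ex := DE _ _ _ q0 xq; have Ey := DE _ _ _ s0 ys.
  rewrite (DE _ (p * s + r * q)) //; last by rewrite tofracD !tofracM -xq -ys; ring.
  rewrite !dD !dM !tofracD !tofracM -xq -ys.
  transitivity ((D x * tofrac q) * tofrac s + (D y * tofrac s) * tofrac q); last by ring.
  by rewrite Ex Ey; ring.
rewrite (DE _ (p * r)) //; last by rewrite !tofracM -xq -ys; ring.
rewrite !dM !tofracD !tofracM -xq -ys.
transitivity ((D x * tofrac q) * (y * tofrac s) + (D y * tofrac s) * (x * tofrac q)); last by ring.
by rewrite Ex Ey; ring.
Qed.

Lemma transport_derivation (K L : fieldType) (f : field_iso K L) (D : K -> K) :
  derivation D -> derivation (fun z => f (D (fi_inv f z))).
Proof.
pose g := fi_inverse f => -[DD DM]; split=> u v.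
  by rewrite [fi_inv f _](rmorphD g) DD rmorphD.
by rewrite [fi_inv f (_ * _)](rmorphM g) DM rmorphD !rmorphM /= !fi_invK.
Qed.

(** The partial derivative with respect to the i-th free generator, carried
    from the field of rational functions to [F]. *)
Lemma coordinate_derivation n (F : fieldType) (b : 'I_n -> F) (i : 'I_n) :
  freely_generates b ->
  exists2 D : F -> F, derivation D & forall j, D (b j) = (i == j)%:R.
Proof.
move=> bF; pose f := cluster_iso bF.
have [D Dder DE] := frac_derivation (conj (mderivD (R := rat) i) (mderivM i)).
exists (fun z => f (D (fi_inv f z))); first exact: transport_derivation.
move=> j; rewrite -(cluster_isoX bF j) -/f fi_funK DE mderivX mnm1E eq_sym.
have [->|_] := eqVneq; last by rewrite scale0r tofrac0 rmorph0.
by rewrite scale1r -[X in (X - _)%MM]add0m addmK mpolyX0 tofrac1 rmorph1.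
Qed.

(** * Logarithmic derivatives *)

Section LogDerivative.
Variables (F : fieldType) (D : F -> F).
Hypothesis Dder : derivation D.
Let DD := Dder.1.
Let DM := Dder.2.

Definition dlog z : F := D z / z.

Lemma dlogM (u v : F) : u != 0 -> v != 0 -> dlog (u * v) = dlog u + dlog v.
Proof. by move=> u0 v0; rewrite /dlog DM; field; rewrite u0 v0. Qed.

Lemma dlog1 : dlog 1 = 0.
Proof.
by apply: (@addrI _ (dlog 1)); rewrite -dlogM ?oner_neq0 // mulr1 addr0.
Qed.

Lemma dlog_div (u v : F) : u != 0 -> v != 0 -> dlog (u / v) = dlog u - dlog v.
Proof.
move=> u0 v0; apply/eqP; rewrite eq_sym subr_eq -dlogM ?divfK //.
by rewrite mulf_neq0 ?invr_eq0.
Qed.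

Lemma dlogX (u : F) k : u != 0 -> dlog (u ^+ k) = k%:R * dlog u.
Proof.
move=> u0; elim: k => [|k IHk]; first by rewrite dlog1 mul0r.
by rewrite exprS dlogM ?expf_neq0 // IHk mulrS mulrDl mul1r.
Qed.

Lemma dlog_monomial (I : finType) (b : I -> F) (m : I -> nat) :
  (forall j, b j != 0) -> dlog (\prod_j b j ^+ m j) = \sum_j (m j)%:R * dlog (b j).
Proof.
move=> b0; apply: proj2 (_ : \prod_j b j ^+ m j != 0 /\ _).
elim/big_ind2: _ => [|u u' v v' [u0 <-] [v0 <-]|j _].
- by rewrite oner_neq0 dlog1.
- by rewrite mulf_neq0 ?dlogM.
- by rewrite expf_neq0 ?dlogX.
Qed.

(** The weights u / (u + v) and v / (u + v) depend on u and v only, and not on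
    the derivation; this is why one scalar serves both arguments in
    [exch_form_mut]. *)
Lemma dlogD (u v : F) : u != 0 -> v != 0 -> u + v != 0 ->
  dlog (u + v) = u / (u + v) * dlog u + (1 - u / (u + v)) * dlog v.
Proof. by move=> u0 v0 uv0; rewrite /dlog DD; field; rewrite u0 v0 uv0. Qed.
End LogDerivative.

(** * The mutation-invariant 2-form *)

Section SkewForm.
Variables (R : comNzRingType) (n : nat).
Implicit Types (Q : quiver 'I_n) (d e : 'I_n -> R).

Definition exch_form Q d e : R := \sum_i \sum_j (exch Q i j)%:~R * d i * e j.

(** Isolating the terms that involve the vertex k, the only ones in which a
    mutation at k changes d or e. *)
Lemma exch_formE Q d e k : exch_form Q d e =
  d k * \sum_(j | j != k) (exch Q k j)%:~R * e j
  - (\sum_(j | j != k) (exch Q k j)%:~R * d j) * e k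
  + \sum_(i | i != k) \sum_(j | j != k) (exch Q i j)%:~R * d i * e j.
Proof.
have exk : exch Q k k = 0 by rewrite /exch arr_loop.
rewrite /exch_form (bigD1 k) //= (bigD1 k) //= exk mul0r mul0r add0r.
under [X in _ + X = _]eq_bigr => i _ do rewrite (bigD1 k) //=.
rewrite big_split /= addrA; congr (_ + _ + _).
  by rewrite mulr_sumr; apply: eq_bigr => j _; rewrite mulrCA mulrA.
by rewrite mulr_suml -sumrN; apply: eq_bigr => j _; rewrite exchN rmorphN !mulNr.
Qed.

(** The linear algebra behind the invariance of the form. Write A and B for the
    sums of d over the arrows into and out of k, and A', B' for those of e. The
    entries b_ij away from k contribute an extra A B' - B A'. The row and the
    column of k change sign, and in them replacing d k by
    - d k + p A + (1 - p) B, and likewise e k, contributes the opposite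
    B A' - A B', whatever p is. *)
Lemma exch_form_mut Q k p d e d' e' :
  (forall j, j != k -> d' j = d j) -> (forall j, j != k -> e' j = e j) ->
  d' k = - d k + p * (\sum_j (Q j k)%:R * d j)
         + (1 - p) * (\sum_j (Q k j)%:R * d j) ->
  e' k = - e k + p * (\sum_j (Q j k)%:R * e j)
         + (1 - p) * (\sum_j (Q k j)%:R * e j) ->
  exch_form (mut_quiver Q k) d' e' = exch_form Q d e.
Proof.
move=> d'E e'E.
have sumE (c : 'I_n -> nat) g : c k = 0%N ->
    \sum_j (c j)%:R * g j = \sum_(j | j != k) (c j)%:R * g j :> R.
  by move=> ck; rewrite (bigD1 k) //= ck mul0r add0r.
rewrite !sumE ?arr_loop //.
set A := \sum_(j | _) _; set B := \sum_(j | _) _ => d'k.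
set A' := \sum_(j | _) _; set B' := \sum_(j | _) _ => e'k.
rewrite !(exch_formE _ _ _ k) d'k e'k.
have rowE (g g' : 'I_n -> R) : (forall j, j != k -> g' j = g j) ->
    \sum_(j | j != k) (exch (mut_quiver Q k) k j)%:~R * g' j =
    \sum_(j | j != k) (Q j k)%:R * g j - \sum_(j | j != k) (Q k j)%:R * g j.
  move=> g'E; rewrite -sumrB; apply: eq_bigr => j jk.
  rewrite exch_mut /mut_mx eqxx /= -exchN /exch rmorphB /= -!pmulrn.
  by rewrite g'E // mulrBl.
have rowQ (g : 'I_n -> R) : \sum_(j | j != k) (exch Q k j)%:~R * g j =
    \sum_(j | j != k) (Q k j)%:R * g j - \sum_(j | j != k) (Q j k)%:R * g j.
  rewrite -sumrB; apply: eq_bigr => j jk.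
  by rewrite /exch rmorphB /= -!pmulrn mulrBl.
rewrite !rowQ (rowE d d') // (rowE e e') // -/A -/B -/A' -/B'.
have -> : \sum_(i | i != k) \sum_(j | j != k)
      (exch (mut_quiver Q k) i j)%:~R * d' i * e' j =
    \sum_(i | i != k) \sum_(j | j != k) (exch Q i j)%:~R * d i * e j
    + (A * B' - B * A').
  rewrite !big_distrlr -sumrB -big_split /=; apply: eq_bigr => i ik.
  rewrite -sumrB -big_split /=; apply: eq_bigr => j jk.
  rewrite exch_mut /mut_mx (negbTE ik) (negbTE jk) /= d'E // e'E //.
  by rewrite rmorphB rmorphD /= -!pmulrn !natrM; ring.
by ring.
Qed.
End SkewForm.

(** * The log form of a labelled seed *)

Section LogForm.
Variables (n : nat) (F : fieldType) (D E : F -> F).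
Hypotheses (Dder : derivation D) (Eder : derivation E).
Implicit Types x : lseed n F.

Definition log_form x : F :=
  exch_form (quiver_of x) (fun i => dlog D (cluster x i))
    (fun i => dlog E (cluster x i)).

Lemma cluster_neq0 x i : cluster x i != 0.
Proof. exact: algind_neq0 (cluster_free x).1. Qed.

(** With M and N the two monomials of the exchange relation at k, the new
    variable is (M + N) / beta_k, so its logarithmic derivative has the shape
    required by [exch_form_mut], with p = M / (M + N). *)
Lemma log_form_mutate x k : log_form (mutate x k) = log_form x.
Proof.
set Q := quiver_of x; set b := cluster x.
pose M := \prod_j b j ^+ Q j k; pose N := \prod_j b j ^+ Q k j.
have monomial0 (m : 'I_n -> nat) : \prod_j b j ^+ m j != 0.
  by apply/prodf_neq0 => j _; rewrite expf_neq0 ?cluster_neq0.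
have MN0 : M + N != 0 := exch_num_neq0 Q k (cluster_free x).1.
have dlog_mut (G : F -> F) : derivation G -> dlog G (cluster (mutate x k) k) =
    - dlog G (b k) + M / (M + N) * (\sum_j (Q j k)%:R * dlog G (b j))
    + (1 - M / (M + N)) * (\sum_j (Q k j)%:R * dlog G (b j)).
  move=> Gder; rewrite ffunE eqxx (dlog_div Gder) ?cluster_neq0 //.
  rewrite -!(dlog_monomial Gder) /=; try exact: cluster_neq0.
  by rewrite [dlog G (M + N)](dlogD Gder) ?monomial0 // -/M -/N; ring.
rewrite /log_form.
apply: (exch_form_mut (p := M / (M + N))); try exact: dlog_mut;
  by move=> j /negbTE jk; rewrite ffunE jk.
Qed.

Lemma log_form_relabel x s : log_form (relabel x s) = log_form x.
Proof.
rewrite /log_form /exch_form [RHS](reindex_inj (@perm_inj _ s)).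
apply: eq_bigr => i _; rewrite [RHS](reindex_inj (@perm_inj _ s)).
by apply: eq_bigr => j _; rewrite !ffunE.
Qed.

Lemma log_form_act x g : log_form (seed_act x g) = log_form x.
Proof.
rewrite /seed_act -(log_form_relabel x (mg_perm g)).
by elim: (mg_word g) (relabel x _) => //= i u IHu y; rewrite IHu log_form_mutate.
Qed.
End LogForm.

(** Evaluated at the i-th and j-th coordinate derivations, the form is
    b_ij / (beta_i beta_j), and [F] has characteristic 0. *)
Lemma quiver_of_log_form n (F : fieldType) (x y : lseed n F) :
  cluster x = cluster y ->
  (forall D E : F -> F, derivation D -> derivation E ->
     log_form D E x = log_form D E y) ->
  quiver_of x = quiver_of y.
Proof.
move=> exy formE; apply: quiver_eq => i j.
suff bE : exch (quiver_of x) i j = exch (quiver_of y) i j by rewrite -!exchK bE.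
have F0 := algind_pchar0 (cluster_free x).1.
have [D Dder Dx] := coordinate_derivation i (cluster_free x).
have [E Eder Ex] := coordinate_derivation j (cluster_free x).
have formxE (z : lseed n F) : cluster z = cluster x -> log_form D E z =
    (exch (quiver_of z) i j)%:~R / (cluster x i * cluster x j).
  move=> ez; rewrite /log_form /exch_form ez (bigD1 i) //= [X in _ + X]big1 => [|k ki].
    rewrite addr0 (bigD1 j) //= [X in _ + X]big1 => [|k kj].
      by rewrite addr0 /dlog Dx Ex !eqxx !mul1r invfM mulrA.
    by rewrite /dlog Ex eq_sym (negbTE kj) mul0r mulr0.
  by apply: big1 => l _; rewrite /dlog Dx eq_sym (negbTE ki) mul0r mulr0 mul0r.
have bij0 : (cluster x i * cluster x j)^-1 != 0.
  by rewrite invr_eq0 mulf_neq0 ?cluster_neq0.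
have := formE D E Dder Eder; rewrite !formxE // => /(mulIf bij0)/eqP.
rewrite -subr_eq0 -rmorphB => exE; apply/eqP; rewrite -subr_eq0.
by apply: contraLR exE => /(intr_neq0 F0).
Qed.

(** * Similar quivers *)

Section Similar.
Variable V : Type.
Implicit Types (Q : quiver V) (C : pred V).

(** It suffices that no arrow crosses the boundary of [C]; unlike connectedness
    this is a local condition, which can be followed through a mutation. *)
Definition reversed_along C Q1 Q2 : Prop :=
  (forall u v, C u != C v -> Q2 u v = 0%N) /\
  (forall u v, Q1 u v = if C u then Q2 v u else Q2 u v).

Lemma similarP Q1 Q2 : similar Q1 Q2 <-> exists C, reversed_along C Q1 Q2.
Proof.
split=> -[C [Cconst QE]]; exists C; split=> // u v; first move=> Cuv.
  apply/eqP; rewrite eqn0Ngt; apply: contra Cuv => uv.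
  by apply/eqP/Cconst/connected_arr.
elim=> {u v} // [u v uv|u v w _ -> _ ->] //.
by apply/eqP; apply: contraLR uv => /Cconst ->.
Qed.

Lemma reversed_alongE C Q1 Q2 u v : reversed_along C Q1 Q2 ->
  Q1 u v = if C v then Q2 v u else Q2 u v.
Proof.
move=> [Cconst ->]; have [-> //|Cuv] := eqVneq (C u) (C v).
by rewrite !Cconst // 1?eq_sym // !if_same.
Qed.

Lemma similar_refl Q : similar Q Q.
Proof. by exists pred0. Qed.

Lemma similar_sym Q1 Q2 : similar Q1 Q2 -> similar Q2 Q1.
Proof.
move=> /similarP[C QC]; apply/similarP; exists C; have [Cconst QE] := QC.
split=> u v; first by move=> Cuv; rewrite QE !Cconst // 1?eq_sym // if_same.
by rewrite (reversed_alongE _ _ QC) QE; case: (C u).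
Qed.

Lemma similar_trans Q2 Q1 Q3 : similar Q1 Q2 -> similar Q2 Q3 -> similar Q1 Q3.
Proof.
move=> /similarP[C QC] /similarP[C' QC']; apply/similarP.
have [Cconst QE] := QC; have [C'const QE'] := QC'.
exists (fun u => C u (+) C' u); split=> u v; last first.
  by rewrite QE (reversed_alongE _ _ QC') QE'; case: (C u); case: (C' u).
have [Cuv|Cuv] := eqVneq (C u) (C v); last move=> _.
  by rewrite Cuv => C'uv; apply: C'const; apply: contraNneq C'uv => ->.
have := Cconst u v Cuv; have Cvu : C v != C u by rewrite eq_sym.
have := Cconst v u Cvu; rewrite (reversed_alongE _ _ QC') QE'.
by case: (C' u) => // _.
Qed.

End Similar.

Lemma similar_pull U V (h : U -> V) (Q1 Q2 : quiver V) :
  similar Q1 Q2 -> similar (pull_quiver h Q1) (pull_quiver h Q2).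
Proof.
move=> /similarP[C [Cconst QE]]; apply/similarP; exists (fun u => C (h u)).
by split=> u v /=; [exact: Cconst|exact: QE].
Qed.

Section SimilarMutation.
Variable V : eqType.
Implicit Types (Q : quiver V) (C : pred V).

(** Mutation at i creates an arrow from u to v only if u, i and v are joined by
    arrows, so [C] stays a union of components. *)
Lemma mut_mx_across Q C i u v : (forall u v, C u != C v -> Q u v = 0%N) ->
  C u != C v -> mut_mx Q i u v = 0.
Proof.
move=> Cconst Cuv; have Cvu : C v != C u by rewrite eq_sym.
have through u' v' : C u' != C v' -> (Q u' i * Q i v' = 0)%N.
  move=> Cuv'; have [Cui|/Cconst -> //] := eqVneq (C u') (C i).
  by rewrite [Q i v']Cconst ?muln0 // -Cui.
by rewrite /mut_mx /exch !through // ![Q _ _]Cconst //; case: ifP.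
Qed.

Lemma similar_mut Q1 Q2 i :
  similar Q1 Q2 -> similar (mut_quiver Q1 i) (mut_quiver Q2 i).
Proof.
move=> /similarP[C QC]; apply/similarP; exists C; have [Cconst QE] := QC.
have Cconst1 u v : C u != C v -> Q1 u v = 0%N.
  by move=> Cuv; rewrite QE !Cconst // 1?eq_sym // if_same.
split=> u v /= => [Cuv|]; first by rewrite (mut_mx_across _ Cconst).
have [Cuv|Cuv] := eqVneq (C u) (C v); last first.
  by rewrite !(mut_mx_across (C := C)) // 1?eq_sym // if_same.
have QiE w : Q1 i w = if C w then Q2 w i else Q2 i w := reversed_alongE i w QC.
rewrite -(fun_if pos_part); congr pos_part.
rewrite /mut_mx /exch !QiE !QE Cuv orbC.
by case: (C v); rewrite // (mulnC (Q2 i u)) (mulnC (Q2 i v)).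
Qed.
End SimilarMutation.

(** * Labelled seeds: similarity and field automorphisms *)

Section LabelledSeeds.
Variables (n : nat) (F : fieldType).
Implicit Types (x y z : lseed n F) (f : field_aut F) (g : mutation_group n).

(** All arrows at i are reversed or none is, so at most the two monomials are
    exchanged. *)
Lemma exch_num_similar (Q1 Q2 : quiver 'I_n) (b : {ffun 'I_n -> F}) i :
  similar Q1 Q2 -> exch_num Q1 b i = exch_num Q2 b i.
Proof.
move=> /similarP[C QC]; rewrite /exch_num.
have QiE k : Q1 i k = if C i then Q2 k i else Q2 i k := QC.2 i k.
have QkE k : Q1 k i = if C i then Q2 i k else Q2 k i := reversed_alongE k i QC.
under eq_bigr do rewrite QkE; under [X in _ + X]eq_bigr do rewrite QiE.
by case: (C i) => //; apply: addrC.
Qed.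

Definition same_cluster_similar x y : Prop :=
  cluster x = cluster y /\ similar (quiver_of x) (quiver_of y).

Lemma same_cluster_similar_act x y g : same_cluster_similar x y ->
  same_cluster_similar (seed_act x g) (seed_act y g).
Proof.
move=> [exy Qxy]; rewrite /seed_act; set s := mg_perm g.
have : same_cluster_similar (relabel x s) (relabel y s).
  by split; [rewrite /= exy|exact: similar_pull].
elim: (mg_word g) (relabel x s) (relabel y s) => //= i u IHu {exy Qxy}x' y' [exy Qxy].
apply: IHu; split; last exact: similar_mut.
by apply/ffunP => j; rewrite !ffunE exy (exch_num_similar _ _ Qxy).
Qed.

Definition image_lseed f x : lseed n F :=
  LSeed (quiver_of x) (free_image f (cluster_free x)).

Lemma image_lseed_act f x g :
  image_lseed f (seed_act x g) = seed_act (image_lseed f x) g.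
Proof.
rewrite /seed_act; set s := mg_perm g.
have <- : image_lseed f (relabel x s) = relabel (image_lseed f x) s.
  by apply: lseed_eq => //; apply/ffunP => i; rewrite !ffunE.
elim: (mg_word g) (relabel x s) => //= i u IHu {}x; rewrite IHu; congr foldl.
apply: lseed_eq => //; apply/ffunP => j; rewrite !ffunE; case: eqP => // _.
rewrite fmorph_div rmorphD !rmorph_prod.
by congr ((_ + _) / _); apply: eq_bigr => k _; rewrite rmorphXn ffunE.
Qed.

Lemma field_aut_eq (b : 'I_n -> F) f f' :
  generates_field b -> (forall i, f (b i) = f' (b i)) -> f = f'.
Proof.
move=> bG ff'; apply: fi_eq => z; apply/eqP.
apply: (bG [pred z | f z == f' z]) => [|i]; last by rewrite inE ff'.
split=> [|u v|u v]; rewrite !inE ?rmorph1 //.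
  by rewrite !rmorphB /= => /eqP -> /eqP ->.
by rewrite !fmorph_div /= => /eqP -> /eqP ->.
Qed.

End LabelledSeeds.

(** * From unlabelled to labelled seeds *)

Section UnlabelledSeeds.
Variables (n : nat) (F : fieldType).
Implicit Types (x y z : lseed n F) (f : field_aut F) (s t : useed n F).

Lemma useed_eq s t : uset s = uset t -> uquiver s = uquiver t -> s = t.
Proof.
case: s t => [A Q As Af] [B R Bs Bf] /= eAB eQR.
move: As Af Bs Bf; rewrite eAB eQR => As Af Bs Bf.
by congr USeed; apply: Prop_irrelevance.
Qed.

Lemma algind_inj (b : 'I_n -> F) : algebraically_independent b -> injective b.
Proof.
move=> bI i j bij; apply/eqP; have F0 := algind_pchar0 bI.
have /bI/(congr1 (mcoeff U_(i)%MM))/eqP : ev F0 b ('X_i - 'X_j) = 0.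
  by rewrite rmorphB !evX bij subrr.
rewrite mcoeffB !mcoeffXU mcoeff0 eqxx (eq_sym j).
by case: (i == j) => //; rewrite subr0 oner_eq0.
Qed.

Lemma cluster_inj x : injective (cluster x).
Proof. exact: algind_inj (cluster_free x).1. Qed.

Lemma pick_cluster x i : [pick j | cluster x j == cluster x i] = Some i.
Proof. by case: pickP => [j /eqP/cluster_inj -> //|/(_ i)]; rewrite eqxx. Qed.

(** The labels can be recovered: this turns a statement about unlabelled
    quivers back into one about quivers on I. *)
Lemma pull_unlabel x : pull_quiver (cluster x) (unlabel_quiver x) = quiver_of x.
Proof. by apply: quiver_eq => i j; rewrite /= /unlabel_arr !pick_cluster. Qed.

Lemma unlabel_relabel x (s : 'S_n) : unlabel (relabel x s) = unlabel x.
Proof.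
have pickE u : [pick i | cluster (relabel x s) i == u]
             = omap s^-1%g [pick i | cluster x i == u].
  case: pickP => [i /eqP|noi].
    by rewrite ffunE => <-; rewrite pick_cluster /= permK.
  case: pickP => //= i /eqP xiu; have := noi (s^-1 i)%g.
  by rewrite ffunE permKV xiu eqxx.
apply: useed_eq => /=.
  apply/fsetP => u; apply/imfsetP/imfsetP => /= [[i _ ->]|[i _ ->]].
    by exists (s i); rewrite // ffunE.
  by exists (s^-1 i)%g; rewrite // ffunE permKV.
apply: quiver_eq => u v; rewrite /= /unlabel_arr !pickE.
case: [pick i | cluster x i == u] => //= i.
by case: [pick i | cluster x i == v] => //= j; rewrite !permKV.
Qed.

Lemma relabel_to x y : uset (unlabel x) = uset (unlabel y) ->
  exists s : 'S_n, cluster (relabel x s) = cluster y.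
Proof.
move=> /fsetP exy.
have /fin_all_exists[h hE] i : exists j, cluster x j = cluster y i.
  have : cluster y i \in uset (unlabel x) by rewrite exy in_imfset.
  by move=> /imfsetP[j _ ->]; exists j.
have h_inj : injective h.
  by move=> i j hij; apply: (@cluster_inj y); rewrite -!hE hij.
by exists (perm h_inj); apply/ffunP => i; rewrite ffunE permE hE.
Qed.

Lemma unlabel_similar x y : same_cluster_similar x y ->
  useed_similar (unlabel x) (unlabel y).
Proof.
move=> [exy /similarP[C [Cconst QE]]]; split; first by rewrite /= exy.
apply/similarP.
(* The same components as vertices of [F]; elements outside the cluster carry
   no arrow, so their value is immaterial. *)
exists (fun u => if [pick i | cluster y i == u] is Some i then C i else false).
split=> u v /=; rewrite /unlabel_arr ?exy.
  by case: pickP => // i _; case: pickP => // j _; apply: Cconst.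
case: pickP => [i _|_] //.
by case: pickP => [j _|_]; rewrite ?if_same.
Qed.

Lemma seed_image_unlabel f x :
  seed_image f (unlabel x) = unlabel (image_lseed f x).
Proof.
apply: useed_eq => /=.
  apply/fsetP => u; apply/imfsetP/imfsetP => /= [[_ /imfsetP[i _ ->] ->]|[i _ ->]].
    by exists i; rewrite ?ffunE.
  by exists (cluster x i); rewrite ?ffunE // in_imfset.
have pickE u : [pick i | cluster x i == fi_inv f u]
             = [pick i | cluster (image_lseed f x) i == u].
  apply: eq_pick => i; rewrite ffunE -[in RHS](fi_invK f u).
  by rewrite (can_eq (@fi_funK _ _ f)).
by apply: quiver_eq => u v; rewrite /= /unlabel_arr !pickE.
Qed.

End UnlabelledSeeds.

(** * Cluster automorphisms and equivariant bijections *)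

(** The image of a subgroup is a subgroup. This is how Aut^c and Aut^+ are seen
    to be groups: closure of Aut^c under inverses is not apparent from its
    definition, which only says that f maps seeds to seeds. *)
Lemma group_isomorphism_onto (G H : groupType) (A : {pred G}) (B : {pred H})
    (f : G -> H) :
  group_closed A -> {in A &, {morph f : u v / (u * v)%g}} ->
  {in A &, injective f} -> (forall h, h \in B <-> exists2 g, g \in A & f g = h) ->
  group_isomorphism A B f.
Proof.
move=> Acl fM f_inj fB; split=> //; have [A1 AV] := Acl.
have f1 : f 1%g = 1%g by apply: (@mulgI _ (f 1%g)); rewrite -fM // !mulg1.
split=> [|h k]; first by apply/fB; exists 1%g.
move=> /fB[u Au <-] /fB[v Av <-]; apply/fB.
have Av' := group_closedV Acl Av.
exists (u * v^-1)%g; first exact: AV.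
by rewrite fM //; congr (_ * _)%g; apply: (@mulgI _ (f v)); rewrite -fM // !mulgV.
Qed.

Section MutationClass.
Variables (n : nat) (F : fieldType) (S : mutation_class n F).
Implicit Types (x y z : mseed S) (u v w : mclass_aut S) (f : field_aut F).

Local Notation "w @ x" := ((w : equiv_aut (mseed_action S)) x)
  (at level 30, no associativity).

Lemma mseed_transitive x y : exists g, y = mseed_act x g.
Proof.
have [x0 Sx0] := in_class_orbit S.
have [/Sx0[h ex] /Sx0[k ey]] := (svalP x, svalP y).
exists (h^-1 * k)%g; apply: mseed_eq => /=.
by rewrite ex -seed_actM mulgA mulgV mul1g.
Qed.

(** Both the uniqueness and the existence half of the isomorphism rest on this
    consequence of the invariance of the log form. *)
Lemma mseed_of_cluster x y : cluster (sval x) = cluster (sval y) -> x = y.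
Proof.
move=> exy; apply: mseed_eq; apply: lseed_eq => //.
apply: quiver_of_log_form => // D E Dder Eder.
by have [g ->] := mseed_transitive x y; rewrite /= log_form_act.
Qed.

Lemma alphaP x w f : alpha x w = f <->
  cluster (sval (w @ x)) = cluster (image_lseed f (sval x)).
Proof.
have alphaE i : alpha x w (cluster (sval x) i) = cluster (sval (w @ x)) i.
  rewrite -[in LHS]seed_isoX -[RHS]seed_isoX.
  exact: (congr1 (seed_iso _) (fi_funK (seed_iso (sval x)) _)).
split=> [<-|wf]; first by apply/ffunP => i; rewrite ffunE alphaE.
apply: (field_aut_eq (cluster_free (sval x)).2) => i.
by rewrite alphaE wf ffunE.
Qed.

Lemma alpha_inj x : injective (@alpha n F S x).
Proof.
move=> u v /alphaP uv; apply: ea_eq => y.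
have {uv}uv : u @ x = v @ x by apply: mseed_of_cluster; rewrite uv; apply/esym/alphaP.
by have [g ->] := mseed_transitive x y; rewrite !(ea_equiv (a := mseed_action S)) uv.
Qed.

Lemma WcP w : reflect
  (forall x, similar (quiver_of (sval (w @ x))) (quiver_of (sval x))) (w \in Wc S).
Proof. exact: asboolP. Qed.

Lemma WplusP w : reflect
  (forall x, quiver_of (sval (w @ x)) = quiver_of (sval x)) (w \in Wplus S).
Proof. exact: asboolP. Qed.

Lemma Wplus_sub_Wc : {subset Wplus S <= Wc S}.
Proof. by move=> w /WplusP wQ; apply/WcP => x; rewrite wQ; apply: similar_refl. Qed.

Lemma Wc_closed : group_closed (Wc S).
Proof.
split=> [|u v /WcP uQ /WcP vQ]; apply/WcP => x /=; first exact: similar_refl.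
apply: similar_trans (uQ _) _; apply: similar_sym.
by have := vQ (ea_inv v x); rewrite (ea_invK v).
Qed.

Lemma Wplus_closed : group_closed (Wplus S).
Proof.
split=> [|u v /WplusP uQ /WplusP vQ]; apply/WplusP => x //=.
by rewrite uQ -[in RHS](ea_invK v x) vQ.
Qed.

(** At the base seed [x] the clusters agree by definition of [alpha x w] and the
    quivers are similar as [w] lies in W^c; both propagate along the orbit. *)
Lemma Wc_image_lseed x y w : w \in Wc S ->
  same_cluster_similar (image_lseed (alpha x w) (sval y)) (sval (w @ y)).
Proof.
move=> /WcP wQ; have [g ->] := mseed_transitive x y.
rewrite (ea_equiv (a := mseed_action S)) /= image_lseed_act.
apply: same_cluster_similar_act; split; last exact/similar_sym/wQ.
by apply/esym/alphaP.
Qed.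

Lemma alpha_base x y w : w \in Wc S -> alpha x w = alpha y w.
Proof. by move=> Ww; apply/esym/alphaP; rewrite (Wc_image_lseed x y Ww).1. Qed.

(** beta_(u v x) o beta_x^-1 factors through beta_(v x), and alpha_u may be
    computed at v x as well as at x. *)
Lemma alphaM x : {in Wc S &, {morph @alpha n F S x : u v / (u * v)%g}}.
Proof.
move=> u v Wu Wv; apply/alphaP/ffunP => i.
rewrite -[LHS]/(cluster (sval (u @ (v @ x))) i) (alphaP (v @ x) u (alpha x u)).1; last exact: alpha_base.
by rewrite ffunE (alphaP x v (alpha x v)).1 // !ffunE.
Qed.

(** The bijection is x0 g |-> y0 g. Instead of checking that it does not depend
    on the choice of g, one takes for w x any seed with the cluster f(beta_x)
    and a quiver similar to that of x: [mseed_of_cluster] makes it unique, so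
    that w is equivariant and inverse to the map built in the same way from
    y0 to x0. *)
Lemma lift_field_aut f x0 y0 :
  same_cluster_similar (image_lseed f (sval x0)) (sval y0) ->
  exists2 w, w \in Wc S & forall x, alpha x w = f.
Proof.
move=> xy0.
have corr g : same_cluster_similar (image_lseed f (sval (mseed_act x0 g)))
    (sval (mseed_act y0 g)).
  by rewrite /= image_lseed_act; apply: same_cluster_similar_act.
have /choice[w wE] x :
    exists y, same_cluster_similar (image_lseed f (sval x)) (sval y).
  by have [g ->] := mseed_transitive x0 x; exists (mseed_act y0 g).
have /choice[w' w'E] y :
    exists x, same_cluster_similar (image_lseed f (sval x)) (sval y).
  by have [g ->] := mseed_transitive y0 y; exists (mseed_act x0 g).
have w'K : cancel w' w.
  by move=> y; apply: mseed_of_cluster; rewrite -(wE _).1 (w'E y).1.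
have wK : cancel w w'.
  move=> x; apply: mseed_of_cluster; apply/ffunP => i.
  have := etrans (w'E (w x)).1 (esym (wE x).1) => /ffunP/(_ i).
  by rewrite !ffunE => /(can_inj (@fi_funK _ _ f)).
have w_act x g : w (mseed_act x g) = mseed_act (w x) g.
  apply: mseed_of_cluster; rewrite -(wE _).1 [image_lseed _ _]image_lseed_act.
  by case: (same_cluster_similar_act g (wE x)).
exists (EquivAut (a := mseed_action S) wK w'K w_act); last first.
  by move=> x; apply/alphaP/esym; exact: (wE x).1.
by apply/WcP => x; apply: similar_sym; case: (wE x).
Qed.

(** An unlabelled seed remembers its cluster up to order, and M_n contains the
    relabellings. *)
Lemma match_unlabelled f x y :
  uset (seed_image f (unlabel (sval x))) = uset (unlabel (sval y)) ->
  exists z, unlabel (sval z) = unlabel (sval y) /\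
    cluster (sval z) = cluster (image_lseed f (sval x)).
Proof.
rewrite seed_image_unlabel => /esym/relabel_to[s sE].
(* The relabelling [s], as an element of M_n with empty mutation word. *)
exists (mseed_act y (@MutGroup n s [::] isT)).
by split; last exact: sE; rewrite /= -[RHS](unlabel_relabel _ s).
Qed.

Lemma Autc_alpha x f : f \in Autc S <-> exists2 w, w \in Wc S & alpha x w = f.
Proof.
split=> [/asboolP fS|[w Ww <-]]; last first.
  apply/asboolP => _ [y ->]; exists (unlabel (sval (w @ y))); first by exists (w @ y).
  by rewrite seed_image_unlabel; apply/unlabel_similar/Wc_image_lseed.
have [_ [y ->] [/match_unlabelled[z [<- zE]] Qsim]] := fS _ (ex_intro _ x erefl).
suff xz : same_cluster_similar (image_lseed f (sval x)) (sval z).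
  by have [w Ww wE] := lift_field_aut xz; exists w.
split; first exact/esym.
rewrite -(pull_unlabel (image_lseed f (sval x))) -(pull_unlabel (sval z)) zE.
by apply: similar_pull; rewrite seed_image_unlabel in Qsim.
Qed.

(** A direct f is in Aut^c, hence lifts to some w in W^c. The seed whose
    unlabelled form is f(y), suitably labelled, has the quiver of y and the
    cluster of w y, so it is w y. *)
Lemma Autplus_alpha x f : f \in Autplus S <-> exists2 w, w \in Wplus S & alpha x w = f.
Proof.
split=> [/asboolP fS|[w Ww <-]]; last first.
  apply/asboolP => _ [y ->]; exists (w @ y); rewrite seed_image_unlabel.
  congr unlabel; apply: lseed_eq; first by rewrite (WplusP _ Ww).
  by case: (Wc_image_lseed x y (Wplus_sub_Wc Ww)).
have fc : f \in Autc S.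
  apply/asboolP => s /fS fs; exists (seed_image f s) => //.
  by split=> //; apply: similar_refl.
have [w Ww wE] := (Autc_alpha x f).1 fc; exists w => //; apply/WplusP => y.
have [y' y'E] := fS _ (ex_intro _ y erefl).
have [z [zy' zE]] := match_unlabelled (congr1 (@uset n F) y'E).
have -> : w @ y = z.
  by apply: mseed_of_cluster; rewrite zE; apply/alphaP; rewrite -(alpha_base x).
rewrite -(pull_unlabel (sval z)) zE -[RHS](pull_unlabel (image_lseed f (sval y))).
move: y'E; rewrite seed_image_unlabel -zy' => /(congr1 (@uquiver n F)) /= <-.
by [].
Qed.
End MutationClass.

Theorem theorem5p1 (n : nat) (n_gt0 : (0 < n)%N) (F : fieldType)
    (F_pt : purely_transcendental n F) (S : mutation_class n F) :
  (forall w, w \in Wc S -> forall x y : mseed S, alpha x w = alpha y w) /\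
  (forall x : mseed S,
     group_isomorphism (Wc S) (Autc S) (alpha x) /\
     group_isomorphism (Wplus S) (Autplus S) (alpha x)).
Proof.
split=> [w Ww x y|x]; first exact: alpha_base.
split; apply: group_isomorphism_onto.
- exact: Wc_closed.
- exact: alphaM.
- by move=> u v _ _; apply: alpha_inj.
- exact: Autc_alpha.
- exact: Wplus_closed.
- by move=> u v /Wplus_sub_Wc Wu /Wplus_sub_Wc Wv; apply: alphaM.
- by move=> u v _ _; apply: alpha_inj.
- exact: Autplus_alpha.
Qed.
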